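(* Let $n\in\mathbb{N}$, let $B$ be an $n\times n$ matrix over $\mathbb{Z}$, and let $\delta=\gcd B$. Let $\phi$ be an automorphism of $\operatorname{cok}B$, let $\psi$ be an automorphism of $\ker B$, and let $M$ be any $n\times n$ matrix over $\mathbb{Z}$ inducing $\phi$, i.e., $\phi([x])=[Mx]$ for all $x\in\mathbb{Z}^n$. Then $\det(M)\equiv\pm1\pmod{\delta}$ if and only if there exist $n\times n$ matrices $U,V\in\mathrm{GL}_n(\mathbb{Z})$ such that $UBV=B$, $U$ induces $\phi$ on $\operatorname{cok}B$, and $V^{-1}$ induces $\psi$ on $\ker B$.
   Context: $\operatorname{cok}B=\mathbb{Z}^n/B\mathbb{Z}^n$ and $\ker B=\{x\in\mathbb{Z}^n: Bx=0\}$. $\gcd B$ is the greatest common divisor of the entries of $B$ (equal to $0$ if $B=0$; congruence modulo $0$ means equality). A matrix $U$ induces $\phi$ on $\operatorname{cok}B$ if $\phi([x])=[Ux]$; if $UBV=B$ then $V^{-1}$ maps $\ker B$ into itself, and $V^{-1}$ induces $\psi$ if $\psi(x)=V^{-1}x$ for $x\in\ker B$. *)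

(* Defs.v *)
From mathcomp Require Import all_boot all_order all_algebra.
Set Implicit Arguments. Unset Strict Implicit. Unset Printing Implicit Defensive.
Import Order.TTheory GRing.Theory Num.Theory.
Local Open Scope ring_scope.

Definition in_img (n : nat) (B : 'M[int]_n) (y : 'cV[int]_n) : Prop :=
  exists x : 'cV[int]_n, y = B *m x.

Definition cok_eq (n : nat) (B : 'M[int]_n) (x y : 'cV[int]_n) : Prop :=
  in_img B (x - y).

Definition in_ker (n : nat) (B : 'M[int]_n) (x : 'cV[int]_n) : Prop :=
  B *m x = 0.

(* A map phi : cok B -> cok B is represented by a lift phi : Z^n -> Z^n,
   phi([x]) = [phi x].  This says the lift is well defined on classes and
   the induced map is a group automorphism of cok B. *)
Definition cok_aut (n : nat) (B : 'M[int]_n) (phi : 'cV[int]_n -> 'cV[int]_n) : Prop :=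
  [/\ (forall x y, cok_eq B x y -> cok_eq B (phi x) (phi y)),
      (forall x y, cok_eq B (phi (x + y)) (phi x + phi y)),
      (forall x y, cok_eq B (phi x) (phi y) -> cok_eq B x y) &
      (forall y, exists x, cok_eq B (phi x) y)].

Definition induces_cok (n : nat) (B : 'M[int]_n) (U : 'M[int]_n)
  (phi : 'cV[int]_n -> 'cV[int]_n) : Prop :=
  forall x, cok_eq B (phi x) (U *m x).

(* psi : Z^n -> Z^n restricted to ker B is a group automorphism of ker B
   (values outside ker B are irrelevant). *)
Definition ker_aut (n : nat) (B : 'M[int]_n) (psi : 'cV[int]_n -> 'cV[int]_n) : Prop :=
  [/\ (forall x, in_ker B x -> in_ker B (psi x)),
      (forall x y, in_ker B x -> in_ker B y -> psi (x + y) = psi x + psi y),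
      (forall x y, in_ker B x -> in_ker B y -> psi x = psi y -> x = y) &
      (forall y, in_ker B y -> exists2 x, in_ker B x & psi x = y)].

Definition induces_ker (n : nat) (B : 'M[int]_n) (W : 'M[int]_n)
  (psi : 'cV[int]_n -> 'cV[int]_n) : Prop :=
  forall x, in_ker B x -> psi x = W *m x.

(* gcd of all entries of B (0 if B = 0) *)
Definition gcd_mx (n : nat) (B : 'M[int]_n) : int :=
  \big[gcdz/0]_(i < n) \big[gcdz/0]_(j < n) B i j.

(* Main.v *)
(* Only the residue of [det M] modulo [gcd B] matters, since two lifts of phi
   differ by a matrix [B X]; this gives one direction.  Conversely, put B in
   Smith form, with first row (d, 0, ..., 0) where d divides every entry.
   Surjectivity of phi says that the rows of [M | B] form a unimodular system,
   and a stable range argument over the integers lets us modify the rows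
   2, ..., n of M modulo those of B so that these n-1 rows alone are unimodular.
   The cofactors along the first row are then coprime, so changing the first
   row by multiples of d moves the determinant by an arbitrary multiple of d and
   reaches 1 or -1.  Finally, ker B is a direct summand, so the automorphism of
   im B = Z^n / ker B induced by U and the prescribed automorphism psi of ker B
   glue to an invertible W with U B = B W, and V is the inverse of W. *)
Require Import Defs.
From HB Require Import structures.
From mathcomp Require Import all_boot all_order all_algebra.
Import Order.TTheory GRing.Theory Num.Theory.
Local Open Scope ring_scope.
Set Implicit Arguments. Unset Strict Implicit. Unset Printing Implicit Defensive.

(** * Smith normal form with its first entry split off *)

Lemma dvdz_mulmx_entries (m n p q : nat) (d : int) (P : 'M[int]_(m, n))
  (A : 'M[int]_(n, p)) (Q : 'M[int]_(p, q)) :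
  (forall i j, d %| A i j)%Z -> forall i j, (d %| (P *m A *m Q) i j)%Z.
Proof.
move=> dA i j; rewrite mxE; apply: rpred_sum => k _; apply: dvdz_mulr.
by rewrite mxE; apply: rpred_sum => l _; apply: dvdz_mull.
Qed.

Lemma Smith_first_block (m n : nat) (B : 'M[int]_(1 + m, 1 + n)) :
  exists P Q d (D : 'M[int]_(m, n)),
    [/\ P \in unitmx, Q \in unitmx, B = P *m block_mx d%:M 0 0 D *m Q
      & forall i j, (d %| D i j)%Z].
Proof.
have [P Pu [Q Qu [d d_sorted ->]]] := int_Smith_normal_form B.
exists P, Q, d`_0, (\matrix_(i, j) (d`_i.+1 *+ (i == j :> nat))).
split=> //.
  congr (_ *m _ *m _); apply/matrixP => i j; rewrite !mxE.
  case: (splitP i) => i' ii'; rewrite !mxE; case: (splitP j) => j' jj';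
    rewrite !mxE ii' jj' ?ord1 ?eqxx //.
move=> i j; rewrite mxE; apply: rpredMn.
(* Past the end of the list the entries are the default 0, which every integer divides. *)
have [lt_i|le_i] := ltnP i.+1 (size d); last by rewrite (nth_default _ le_i) dvdz0.
apply: (sorted_ltn_nth _ _ d_sorted) => //; first exact: (@dvdz_trans).
by rewrite inE (leq_ltn_trans _ lt_i).
Qed.

Lemma dvdz_block_scalar (m n : nat) (d : int) (D : 'M[int]_(m, n)) :
  (forall i j, d %| D i j)%Z ->
  forall i j, (d %| block_mx (d%:M : 'M_1) 0 0 D i j)%Z.
Proof.
move=> dD i j; rewrite /block_mx !mxE; case: splitP => i' _; rewrite !mxE;
  case: splitP => j' _; rewrite ?mxE ?dvdz0 //.
exact: rpredMn.
Qed.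

(** * Unimodular rows, stable range and completion over the integers *)

Lemma row_gcd_factor (m : nat) (a : 'rV[int]_(1 + m)) :
  exists2 g : int, exists2 R, R \in unitmx & a = row_mx g%:M 0 *m R
    & exists u y, a = g *: u /\ u *m y = 1%:M :> 'M_1.
Proof.
have [P [R [d [D [Pu Ru eq_a _]]]]] := @Smith_first_block 0 m a.
(* The left factor in the Smith form of a single row is a 1 by 1 unit, absorbed into the gcd. *)
have [p Pp] : exists p, P = p%:M by exists (P 0 0); rewrite -mx11_scalar.
have p_unit : p \is a GRing.unit by move: Pu; rewrite Pp unitmxE det_scalar1.
have aE : a = row_mx (p * d)%:M 0 *m R.
  have blockE : @block_mx _ 1 0 1 m d%:M 0 0 D = row_mx d%:M 0 :> 'rV_(1 + m).
    apply/matrixP => i j.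
    have ->: i = @lshift 1 0 0 by apply: val_inj; case: i => [[]].
    by apply: etrans (col_mxEu _ _ _ _) _; congr (row_mx _ _ _ _); apply: val_inj.
  rewrite eq_a Pp mul_scalar_mx blockE.
  by rewrite scale_row_mx scaler0 scale_scalar_mx.
exists (p * d); first by exists R.
exists (row_mx 1%:M 0 *m R), (invmx R *m col_mx 1%:M 0); split.
  by rewrite scalemxAl scale_row_mx scaler0 scale_scalar_mx mulr1.
by rewrite mulmxA mulmxK // mul_row_col mul1mx mul0mx addr0.
Qed.

Lemma row_factor (k : nat) (c : 'rV[int]_k) :
  exists h u (y : 'cV_k), c = h *: u /\ c *m y = h%:M.
Proof.
case: k c => [|k] c.
  exists 0, 0, 0; split; first by rewrite !thinmx0.
  by rewrite mulmx0 raddf0.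
have [h _ [u [y [cE uy]]]] := @row_gcd_factor k c.
by exists h, u, y; split=> //; rewrite cE -scalemxAl uy scale_scalar_mx mulr1.
Qed.

Lemma unimodular_row (m : nat) (a : 'rV[int]_(1 + m)) (z : 'cV[int]_(1 + m)) :
  a *m z = 1%:M -> exists2 R, R \in unitmx & a = row_mx 1%:M 0 *m R.
Proof.
have [g [R Ru aE] [u [y [aE' uy]]]] := row_gcd_factor a.
rewrite aE' -scalemxAl => /matrixP/(_ 0 0); rewrite mxE [1%:M _ _]mxE => gu1.
have g_unit : g \is a GRing.unit by apply/unitrPr; exists ((u *m z) 0 0).
exists (g *: R); first by rewrite unitmxZ.
by rewrite -scalemxAr scalemxAl scale_row_mx scaler0 scale_scalar_mx mulr1 -aE.
Qed.

Lemma row_stable_range (m k : nat) (a : 'rV[int]_(1 + (1 + m))) (c : 'rV[int]_k)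
  z z' : a *m z + c *m z' = 1%:M ->
  exists x, exists2 R, R \in unitmx & a + c *m x = row_mx 1%:M 0 *m R.
Proof.
(* In suitable coordinates a = (g, 0, ..., 0), and two columns are available:
   x places h = gcd c next to g. *)
move=> uni.
have [g [R Ru aE] _] := row_gcd_factor a.
have [h [u [y [cE cy]]]] := row_factor c.
exists (y *m row_mx 0 (row_mx 1%:M 0) *m R).
apply: (@unimodular_row _ _ (invmx R *m
  col_mx (usubmx (R *m z)) (col_mx (u *m z') 0))).
rewrite !mulmxA cy {1}aE -mulmxDl mulmxK // mul_scalar_mx.
rewrite !scale_row_mx !scaler0 add_row_mx addr0 add0r !mul_row_col.
rewrite mul0mx addr0 -scalemxAl mul1mx scalemxAl -cE -uni aE -mulmxA.
by rewrite -[R *m z in RHS]vsubmxK [in RHS]mul_row_col mul0mx addr0.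
Qed.

(** Induction on rows: [row_stable_range] turns the first row into (1, 0, ..., 0) up to [R], and the
    lower rows keep one spare column, which provides the two columns needed at each step. *)
Lemma unimodular_stable_range (m k : nat) (A : 'M[int]_(m, 1 + m))
  (C : 'M[int]_(m, k)) Z Z' : A *m Z + C *m Z' = 1%:M ->
  exists X W, (A + C *m X) *m W = 1%:M.
Proof.
elim: m => [|m IHm] in A C Z Z' *.
  by move=> _; exists 0, 0; rewrite [RHS]flatmx0 [LHS]flatmx0.
move: A C Z Z'; change m.+1 with (1 + m)%N => A C Z Z' uni.
have uni_row : usubmx A *m lsubmx Z + usubmx C *m lsubmx Z' = 1%:M.
  rewrite !mulmx_lsub !mul_usub_mx -!raddfD /= uni scalar_mx_block.
  by rewrite /block_mx col_mxKu row_mxKl.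
have [x [R Ru eq_row]] := row_stable_range uni_row.
pose A1 := (A + C *m x) *m invmx R.
have eqA1 : A1 = block_mx 1%:M 0 (lsubmx (dsubmx A1)) (rsubmx (dsubmx A1)).
  rewrite -[LHS]vsubmxK block_mxEv hsubmxK; congr col_mx.
  rewrite -mul_usub_mx linearD /= -mul_usub_mx eq_row mulmxK //.
set v := lsubmx _ in eqA1; set A' := rsubmx _ in eqA1.
(* Clearing v with the first row turns the lower rows of [A1 | C] into [0 A' | C']. *)
pose c := usubmx C; pose C' := dsubmx C - v *m c.
have CE : C = col_mx c (v *m c + C') by rewrite addrC subrK vsubmxK.
pose z1 := usubmx (R *m Z); pose z2 := dsubmx (R *m Z); pose y := Z' - x *m Z.
have uni1 : A1 *m (R *m Z) + C *m y = 1%:M.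
  by rewrite mulmxBr mulmxA mulmxKV // mulmxDl -uni !mulmxA addrACA subrr addr0.
have [top bot] : z1 + c *m y = row_mx 1%:M 0
    /\ v *m (z1 + c *m y) + (A' *m z2 + C' *m y) = row_mx 0 1%:M.
  clearbody y; apply: eq_col_mx; rewrite -block_mxEv -scalar_mx_block -uni1 eqA1.
  rewrite CE -[R *m Z]vsubmxK mul_block_col mul_col_mx add_col_mx.
  by rewrite mul1mx mul0mx addr0 mulmxDr mulmxDl mulmxA addrACA.
(* Past the first column the right-hand side of [top] vanishes, so [bot] restricts to the hypothesis
   for [A'] and [C']. *)
have [|X' [W']] := IHm A' C' (rsubmx z2) (rsubmx y).
  rewrite !mulmx_rsub -raddfD /= -(addKr (v *m (z1 + c *m y)) (_ + _)) bot top.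
  by rewrite mul_mx_row mulmx0 mulmx1 opp_row_mx oppr0 add_row_mx row_mxKr add0r.
move=> unW; exists (x + row_mx 0 X' *m R).
(* The last block factor clears [v]; the first one is a right inverse of the upper triangular matrix
   that remains. *)
exists (invmx R *m (block_mx 1%:M (- (c *m X' *m W')) 0 W' *m
                    block_mx 1%:M 0 (- v) 1%:M)).
have AE : A + C *m (x + row_mx 0 X' *m R) = (A1 + C *m row_mx 0 X') *m R.
  by rewrite mulmxDl mulmxKV // mulmxDr addrA mulmxA.
rewrite AE mulmxA mulmxK // eqA1 CE mul_col_row add_block_mx.
rewrite !mulmx0 !addr0 add0r [_ *m (block_mx _ _ _ _ *m _)]mulmxA mulmx_block.
have -> : v *m - (c *m X' *m W') + (A' + (v *m c + C') *m X') *m W' = 1%:M.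
  by rewrite -unW mulmxN !mulmxDl !mulmxA (addrCA (A' *m W')) addKr.
rewrite !mul1mx !mulmx0 !mulmx1 !addr0 addNr mulmx_block.
rewrite !mul1mx !mul0mx !mulmx0 !mulmx1 !addr0 add0r subrr.
by rewrite -scalar_mx_block.
Qed.

Lemma unimodular_completion (m : nat) (A : 'M[int]_(m, 1 + m)) W :
  A *m W = 1%:M -> exists r, col_mx r A \in unitmx.
Proof.
(* The idempotent E has trace 1, so its entries are coprime and r E y is a unit
   for some r, y; the determinant identity below shows that r works. *)
move=> AW; pose E := 1%:M - W *m A.
have [P [Q [d [D [Pu Qu eqE dD]]]]] := Smith_first_block E.
have trE : \tr E = 1.
  by rewrite raddfB /= mxtrace_mulC AW !mxtrace1 natrD addrK.
have d_unit : d \is a GRing.unit.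
  have: (d %| \tr E)%Z.
    apply: rpred_sum => i _; rewrite eqE; apply: dvdz_mulmx_entries.
    exact: dvdz_block_scalar.
  by rewrite trE dvdz1 => d1; case: (d) d1 => [[|[]]|[]].
pose r := row_mx 1%:M 0 *m invmx P; pose y := invmx Q *m col_mx 1%:M 0.
have rEy : r *m E *m y = d%:M.
  rewrite eqE /r /y !mulmxA mulmxKV // mulmxK // mul_row_block.
  by rewrite mul1mx !mulmx0 mul0mx !addr0 mul_row_col mulmx0 addr0 mulmx1.
exists r.
have: block_mx 1%:M (- (r *m W)) 0 1%:M *m (col_mx r A *m row_mx y W)
      = block_mx d%:M 0 (A *m y) 1%:M.
  rewrite mul_col_row mulmx_block AW !mul1mx !mul0mx mulmx1 !add0r subrr.
  by congr block_mx; rewrite -rEy /E mulmxBr mulmx1 mulmxBl mulNmx !mulmxA.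
move/(congr1 (fun T => \det T)).
rewrite det_lblock !det_mulmx det_ublock !det1 !mul1r mulr1 det_scalar1 => dE.
by move: d_unit; rewrite -dE unitrM unitmxE => /andP[].
Qed.

(** * Determinants modulo [d] *)

Lemma dvdz_prod_sub (I : Type) (r : seq I) (d : int) (F G : I -> int) :
  (forall i, d %| F i - G i)%Z ->
  (d %| \prod_(i <- r) F i - \prod_(i <- r) G i)%Z.
Proof.
move=> FG; apply: (big_rec2 (fun x y => d %| x - y)%Z); first by rewrite subrr dvdz0.
move=> i x y _ xy.
have -> : F i * x - G i * y = F i * (x - y) + (F i - G i) * y.
  by rewrite mulrBr mulrBl addrA subrK.
by apply: rpredD; [apply: dvdz_mull | apply: dvdz_mulr].
Qed.

Lemma det_congr (n : nat) (d : int) (A B : 'M[int]_n) :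
  (forall i j, d %| A i j - B i j)%Z -> (d %| \det A - \det B)%Z.
Proof.
move=> AB; rewrite -sumrB; apply: rpred_sum => s _; rewrite -mulrBr.
by apply: dvdz_mull; apply: dvdz_prod_sub.
Qed.

(** The cofactors along the first row involve only [A], so those computed with the row 0 serve for
    every [r]. *)
Lemma det_col_mx_linear (m : nat) (A : 'M[int]_(m, 1 + m)) :
  exists c : 'cV_(1 + m), forall r, \det (col_mx r A) = (r *m c) 0 0.
Proof.
pose cof (r : 'rV_(1 + m)) := \col_j cofactor (col_mx r A) (lshift m 0) j.
exists (cof 0) => r; rewrite (expand_det_row _ (lshift m 0)) mxE.
apply: eq_bigr => j _; rewrite col_mxEu mxE; congr (_ * (_ * \det _)).
apply/matrixP => i k; rewrite !mxE; case: splitP => // i'.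
by rewrite ord1.
Qed.

(** * Correcting [M] by a multiple of [B] to an invertible matrix *)

Lemma lift_first_block_to_unit (m : nat) (d e : int) (D : 'M[int]_m)
  (M : 'M[int]_(1 + m)) Z Z' :
  (forall i j, d %| D i j)%Z -> e \is a GRing.unit -> (d %| \det M - e)%Z ->
  M *m Z + block_mx d%:M 0 0 D *m Z' = 1%:M ->
  exists X, M + block_mx d%:M 0 0 D *m X \in unitmx.
Proof.
move=> dD e_unit dM uni.
(* Below the first row the block matrix is (0, [D]), so only [D] survives there. *)
have uniA : dsubmx M *m rsubmx Z + D *m rsubmx (dsubmx Z') = 1%:M.
  have -> : D *m rsubmx (dsubmx Z')
      = rsubmx (dsubmx (block_mx d%:M 0 0 D *m Z')).
    by rewrite -{2}[Z']vsubmxK mul_block_col !mul0mx addr0 add0r col_mxKd mulmx_rsub.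
  rewrite mulmx_rsub mul_dsub_mx -!raddfD /= uni scalar_mx_block.
  by rewrite /block_mx col_mxKd row_mxKr.
have [X [W AW]] := unimodular_stable_range uniA.
have [r r_unit] := unimodular_completion AW.
set A := _ + _ in AW r_unit.
have [c cE] := det_col_mx_linear A.
have : (d %| \det (col_mx (usubmx M) A) - e)%Z.
  rewrite -(subrK (\det M) (\det (col_mx _ _))) -addrA; apply: rpredD => //.
  apply: det_congr => i j; rewrite -[in X in _ - X](vsubmxK M).
  case: (split_ordP i) => k ->; first by rewrite !col_mxEu subrr dvdz0.
  rewrite !col_mxEd [A k j]mxE addrAC subrr add0r mxE.
  by apply: rpred_sum => l _; apply: dvdz_mulr.
case/dvdzP => q qE; pose u := (r *m c) 0 0.
have uu : u * u = 1.
  by move: r_unit; rewrite unitmxE cE -/u; case: (u) => [[|[]]|[]].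
(* Here [u] is the determinant of [col_mx r A], hence 1 or -1. Subtracting [d * q * u] times [r]
   from the first row takes the determinant from [e + q * d] to [e]. *)
exists (col_mx (- (q * u) *: r) X).
have -> : M + block_mx d%:M 0 0 D *m col_mx (- (q * u) *: r) X
    = col_mx (usubmx M - (d * q * u) *: r) A.
  rewrite mul_block_col -{1}[M]vsubmxK add_col_mx !mul0mx addr0 add0r.
  by rewrite mul_scalar_mx scalerA mulrN scaleNr mulrA.
rewrite unitmxE cE mulmxBl -scalemxAl.
have -> : (usubmx M *m c - (d * q * u) *: (r *m c)) 0 0
    = \det (col_mx (usubmx M) A) - d * q * u * u.
  by rewrite cE mxE; congr (_ + _); rewrite mxE; congr (- _); rewrite mxE.
by rewrite -(mulrA _ u) uu mulr1 (mulrC d) -qE subKr.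
Qed.

Lemma dvdz_big_gcd (I : finType) (d : int) (F : I -> int) :
  (d %| \big[gcdz/0]_i F i)%Z <-> forall i, (d %| F i)%Z.
Proof.
have -> : (d %| \big[gcdz/0]_i F i)%Z = all (fun i => d %| F i)%Z (index_enum I).
  elim: (index_enum I) => [|i r IHr]; first by rewrite big_nil dvdz0.
  by rewrite big_cons dvdz_gcd IHr.
by split=> [/allP dF i|dF]; [apply: dF; rewrite mem_index_enum | apply/allP].
Qed.

Lemma dvdz_gcd_mx (n : nat) (d : int) (B : 'M[int]_n) :
  (d %| gcd_mx B)%Z <-> forall i j, (d %| B i j)%Z.
Proof.
rewrite /gcd_mx; split=> [/dvdz_big_gcd dB i j|dB].
  by have /dvdz_big_gcd := dB i.
by apply/dvdz_big_gcd => i; apply/dvdz_big_gcd.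
Qed.

Lemma lift_to_unit (n : nat) (e : int) (B M Z Z' : 'M[int]_n) :
  M *m Z + B *m Z' = 1%:M -> e \is a GRing.unit ->
  (gcd_mx B %| \det M - e)%Z -> exists X, M + B *m X \in unitmx.
Proof.
case: n B M Z Z' => [|m] B M Z Z' uni e_unit gM.
  by exists 0; rewrite unitmxE det_mx00.
move: B M Z Z' uni gM; change m.+1 with (1 + m)%N => B M Z Z' uni gM.
have [P [Q [d [D [Pu Qu BE dD]]]]] := Smith_first_block B.
have dB i j : (d %| B i j)%Z.
  by rewrite BE; apply: dvdz_mulmx_entries; apply: dvdz_block_scalar.
have dg : (d %| gcd_mx B)%Z by apply/dvdz_gcd_mx.
(* Conjugation by [P] keeps the determinant and replaces [B] by its Smith form. *)
have [X MX] : exists X, invmx P *m M *m P + block_mx d%:M 0 0 D *m X \in unitmx.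
  apply: (@lift_first_block_to_unit _ _ e _ _ (invmx P *m Z *m P) (Q *m Z' *m P)) => //.
    apply: dvdz_trans dg _; rewrite !det_mulmx det_inv mulrC mulrA mulrV ?mul1r //.
  rewrite !mulmxA mulmxK // -(mulmxA _ M Z).
  have -> : block_mx d%:M 0 0 D *m Q = invmx P *m B.
    by rewrite BE !mulmxA mulVmx ?mul1mx.
  by rewrite -(mulmxA _ B) -mulmxDl -mulmxDr uni mulmx1 mulVmx.
exists (invmx Q *m X *m invmx P).
have -> : M + B *m (invmx Q *m X *m invmx P)
    = P *m (invmx P *m M *m P + block_mx d%:M 0 0 D *m X) *m invmx P.
  rewrite BE mulmxDr mulmxDl !mulmxA mulmxK // mulmxV // mul1mx mulmxK //.
by rewrite !unitmx_mul Pu MX unitmx_inv.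
Qed.

(** * Matrices from columns and additive maps; the kernel as a summand *)

Lemma mulmx_cols_exist (m n p : nat) (A : 'M[int]_(m, n)) (B : 'M[int]_(m, p)) :
  (forall j, exists x, col j B = A *m x) -> exists X, B = A *m X.
Proof.
move=> AB; have [f fP] := fin_all_exists AB.
exists (\matrix_(i, j) f j i 0); apply/matrixP => i j.
move/matrixP/(_ i 0): (fP j); rewrite !mxE => ->.
by apply: eq_bigr => k _; rewrite mxE.
Qed.

Lemma additive_matrix (n : nat) (f : 'cV[int]_n -> 'cV[int]_n) :
  {morph f : x y / x + y} -> exists F : 'M[int]_n, forall x, f x = F *m x.
Proof.
move=> fD.
have fB : zmod_morphism f.
  by move=> x y; apply: (addIr (f y)); rewrite -fD !subrK.
pose fa : {additive 'cV[int]_n -> 'cV[int]_n} :=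
  HB.pack f (GRing.isZmodMorphism.Build _ _ f fB).
have fE : f =1 fa by [].
exists (\matrix_(i, j) f (delta_mx j 0) i 0) => x.
rewrite {1}[x]matrix_sum_delta fE raddf_sum.
apply/matrixP => i k; rewrite ord1 summxE mxE; apply: eq_bigr => j _.
rewrite big_ord1 -[x j 0]intz scaler_int raddfMz /=.
by rewrite -scaler_int intz [LHS]mxE [X in _ = X * _]mxE mulrC.
Qed.

(** In Smith coordinates the kernel is spanned by the basis vectors with invariant factor 0; [K]
    projects onto them. *)
Lemma ker_projector (n : nat) (B : 'M[int]_n) :
  exists E : 'M[int]_n, B *m E = 0 /\ (forall x : 'cV_n, B *m x = 0 -> E *m x = x).
Proof.
have [P Pu [Q Qu [d _ ->]]] := int_Smith_normal_form B.
set D := \matrix_(i, j) _.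
pose K : 'M[int]_n := \matrix_(i, j) ((d`_i == 0) && (i == j))%:R.
have DE (x : 'cV_n) i : (D *m x) i 0 = d`_i * x i 0.
  rewrite mxE (bigD1 i) //= big1 => [|j ji]; last first.
    by rewrite mxE -val_eqE /= in ji *; rewrite eq_sym (negPf ji) mul0r.
  by rewrite addr0 mxE eqxx.
have KE (x : 'cV_n) i : (K *m x) i 0 = (d`_i == 0)%:R * x i 0.
  rewrite mxE (bigD1 i) //= big1 => [|j ji]; last first.
    by rewrite mxE (eq_sym i) (negPf ji) andbF mul0r.
  by rewrite addr0 mxE eqxx andbT.
exists (invmx Q *m K *m Q); split.
  have DK : D *m K = 0.
    apply/matrixP => i j; rewrite mxE big1 ?mxE // => k _; rewrite !mxE.
    case: eqVneq => [/val_inj <-|]; last by rewrite mul0r.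
    by case: eqVneq => [->|_]; rewrite ?mul0r // mulr0.
  by rewrite !mulmxA mulmxK // -(mulmxA P) DK mulmx0 mul0mx.
move=> x; rewrite -!mulmxA => /(congr1 (mulmx (invmx P))).
rewrite mulmx0 mulKmx // => DQx.
rewrite (_ : K *m (Q *m x) = Q *m x) ?mulKmx //.
move: (Q *m x) DQx => w Dw; apply/matrixP => i j; rewrite ord1 KE.
move/matrixP/(_ i 0): Dw; rewrite DE mxE => /eqP.
rewrite mulf_eq0; case: eqVneq => _ /=; first by rewrite mul1r.
by move=> /eqP ->; rewrite mulr0.
Qed.

(** * Automorphisms of cokernel and kernel *)

Lemma cok_eq_sym (n : nat) (B : 'M[int]_n) x y : cok_eq B x y -> cok_eq B y x.
Proof. by case=> z xyz; exists (- z); rewrite mulmxN -xyz opprB. Qed.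

Lemma cok_eq_trans (n : nat) (B : 'M[int]_n) x y z :
  cok_eq B x y -> cok_eq B y z -> cok_eq B x z.
Proof.
case=> u xyu [v yzv]; exists (u + v).
by rewrite mulmxDr -xyu -yzv addrA subrK.
Qed.

Lemma cok_eq0 (n : nat) (B : 'M[int]_n) x : cok_eq B x 0 = in_img B x.
Proof. by rewrite /cok_eq subr0. Qed.

(** The lift [phi] need not fix 0, but [phi 0] lies in the image of [B] because [U *m 0 = 0];
    injectivity on classes then gives the forward direction. *)
Lemma in_img_induces (n : nat) (B U : 'M[int]_n) phi x :
  cok_aut B phi -> induces_cok B U phi -> in_img B (U *m x) <-> in_img B x.
Proof.
move=> [phi_wd _ phi_inj _] Uphi.
have phi0 : cok_eq B (phi 0) 0 by have := Uphi 0; rewrite mulmx0.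
rewrite -!cok_eq0; split=> [Ux|/phi_wd phix].
  apply: phi_inj; apply: cok_eq_trans (Uphi x) _.
  exact: cok_eq_trans Ux (cok_eq_sym phi0).
apply: cok_eq_trans (cok_eq_sym (Uphi x)) _.
exact: cok_eq_trans phix phi0.
Qed.

Lemma ker_aut_extension (n : nat) (B U : 'M[int]_n) phi psi :
  cok_aut B phi -> ker_aut B psi -> U \in unitmx -> induces_cok B U phi ->
  exists W : 'M[int]_n, [/\ W \in unitmx, U *m B = B *m W & induces_ker B W psi].
Proof.
move=> phi_aut [psi_ker psiD _ psi_surj] Uu Uphi.
have [E [BE Efix]] := ker_projector B.
have E_ker x : in_ker B (E *m x) by rewrite /in_ker mulmxA BE mul0mx.
(* [psi] is additive on the kernel only; precomposing with [E] makes it additive everywhere. *)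
have [F FE] : exists F : 'M[int]_n, forall x, psi (E *m x) = F *m x.
  by apply: additive_matrix => x y; rewrite mulmxDr psiD.
have BF : B *m F = 0.
  have [|X ->] := @mulmx_cols_exist _ _ _ E F; last first.
    by rewrite mulmxA BE mul0mx.
  move=> j; exists (F *m delta_mx j 0); rewrite Efix ?colE //.
  by rewrite -FE; apply: psi_ker.
have [W0 UBE] : exists W0, U *m B = B *m W0.
  apply: mulmx_cols_exist => j; rewrite colE -mulmxA.
  by apply/(in_img_induces _ phi_aut Uphi); exists (delta_mx j 0).
(* [F] is psi composed with the projector E, [W0] is U on im B. *)
pose W := F + W0 *m (1%:M - E).
have BW : U *m B = B *m W.
  rewrite mulmxDr BF add0r mulmxA -UBE mulmxBr mulmx1.
  by rewrite -(mulmxA U) BE mulmx0 subr0.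
have W_ker : induces_ker B W psi.
  move=> x Bx; rewrite mulmxDl -mulmxA mulmxBl mul1mx Efix // subrr mulmx0 addr0.
  by rewrite -FE Efix.
exists W; split=> //.
(* It suffices that [W] is onto. Given [y], some [x] has [B *m y = U *m (B *m x)]; then [y - W *m x]
   is in the kernel, where [W] acts as the surjective [psi]. *)
have [|X WX] := @mulmx_cols_exist _ _ _ W 1%:M.
  move=> j; set y := col j _.
  have [x xE] : in_img B (invmx U *m (B *m y)).
    by apply/(in_img_induces _ phi_aut Uphi); exists y; rewrite mulKVmx.
  have [|k Bk kE] := psi_surj (y - W *m x).
    by rewrite /in_ker mulmxBr (mulmxA B) -BW -mulmxA -xE mulKVmx // subrr.
  by exists (k + x); rewrite mulmxDr -W_ker // kE subrK.
by have [] := mulmx1_unit (esym WX).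
Qed.

Theorem theorem4p1 (n : nat) (B : 'M[int]_n)
  (phi psi : 'cV[int]_n -> 'cV[int]_n) (M : 'M[int]_n) :
  cok_aut B phi -> ker_aut B psi -> induces_cok B M phi ->
  ((\det M == 1 %[mod gcd_mx B])%Z || (\det M == -1 %[mod gcd_mx B])%Z) <->
  (exists U V : 'M[int]_n,
     [/\ U \in unitmx, V \in unitmx, U *m B *m V = B,
         induces_cok B U phi & induces_ker B (invmx V) psi]).
Proof.
move=> phi_aut psi_aut Mphi; split.
  have [Z [Z' uni]] : exists Z Z' : 'M[int]_n, M *m Z + B *m Z' = 1%:M.
    (* Surjectivity of [phi] writes each basis vector as [M *m x + B *m z]. *)
    have [|T TE] := @mulmx_cols_exist _ _ _ (row_mx M B) 1%:M.
      move=> j; have [_ _ _ /(_ (col j 1%:M)) [x xE]] := phi_aut.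
      have [z zE] := cok_eq_trans (cok_eq_sym xE) (Mphi x).
      by exists (col_mx x z); rewrite mul_row_col -zE addrC subrK.
    exists (usubmx T), (dsubmx T).
    by rewrite -mul_row_col vsubmxK -TE.
  move=> detM; have [e e_unit gM] :
      exists2 e : int, e \is a GRing.unit & (gcd_mx B %| \det M - e)%Z.
    by case/orP: detM; rewrite eqz_mod_dvd; [exists 1 | exists (-1)].
  have [X Uu] := lift_to_unit uni e_unit gM.
  have Uphi : induces_cok B (M + B *m X) phi.
    move=> x; apply: cok_eq_trans (Mphi x) _; exists (- (X *m x)).
    by rewrite mulmxDl opprD addrA subrr add0r mulmxN mulmxA.
  have [W [Wu BW Wpsi]] := ker_aut_extension phi_aut psi_aut Uu Uphi.
  exists (M + B *m X), (invmx W).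
  by rewrite unitmx_inv invmxK BW mulmxK.
case=> U [_ [Uu _ _ Uphi _]].
(* Both matrices induce [phi], so the columns of their difference lie in the image of [B]. *)
have [X MUX] : exists X, M - U = B *m X.
  apply: mulmx_cols_exist => j; rewrite colE mulmxBl.
  exact: cok_eq_trans (cok_eq_sym (Mphi _)) (Uphi _).
have MU : (gcd_mx B %| \det M - \det U)%Z.
  apply: det_congr => i j.
  have -> : M i j - U i j = (B *m X) i j by rewrite -MUX !mxE.
  rewrite mxE; apply: rpred_sum => k _; apply: dvdz_mulr.
  by apply: (dvdz_gcd_mx _ B).1.
have: \det U \in [:: 1; -1].
  by move: Uu; rewrite unitmxE; case: (\det U) => [[|[]]|[]].
by rewrite !inE !eqz_mod_dvd => /orP[]/eqP UE; rewrite -UE MU ?orbT.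
Qed.
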